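(* Let $E$ be a pseudo effect algebra with (RDP). Then every measure $m$ on $E$ can be uniquely expressed in the form $m=m_1+m_2$, where $m_1\in\mathcal M^+(E)_\sigma$ and $m_2$ is a (finitely additive) measure on $E$ such that if $t\in\mathcal M^+(E)_\sigma$ and $t\le^+m_2$, then $t=0$. In particular, every state $s$ on $E$ can be uniquely expressed as a convex combination $s=\lambda_1s_1+\lambda_2s_2$, where $s_1$ is a $\sigma$-additive state and $s_2$ is a (finitely additive) state such that if $\alpha s'\le^+s_2$ for some $\sigma$-additive state $s'$ on $E$ and some constant $\alpha\ge0$, then $\alpha=0$.
   Context: A pseudo effect algebra is a partial algebra $(E;+,0,1)$ with a partial binary operation $+$ and constants $0,1$ such that for all $a,b,c\in E$: (i) $a+b$ and $(a+b)+c$ exist iff $b+c$ and $a+(b+c)$ exist, and then $(a+b)+c=a+(b+c)$; (ii) there is exactly one $d$ and exactly one $e$ in $E$ with $a+d=e+a=1$; (iii) if $a+b$ exists, there are $d,e\in E$ with $a+b=d+a=b+e$; (iv) if $1+a$ or $a+1$ exists, then $a=0$. The partial order is $a\le b$ iff $a+c=b$ for some $c\in E$. $E$ has (RDP) if whenever $a_1+a_2=b_1+b_2$ (both sums defined), there are $d_1,d_2,d_3,d_4\in E$ with $d_1+d_2=a_1$, $d_3+d_4=a_2$, $d_1+d_3=b_1$, $d_2+d_4=b_2$. A measure on $E$ is a map $m:E\to[0,\infty)$ with $m(a+b)=m(a)+m(b)$ whenever $a+b$ is defined; a state is a measure with $s(1)=1$. $m_1\le^+m_2$ means $m_1(a)\le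 m_2(a)$ for all $a\in E$. A measure $m$ is $\sigma$-additive if $a_n\le a_{n+1}$ for all $n\ge1$ and $\bigvee_na_n=a$ in $E$ imply $m(a)=\lim_nm(a_n)$. $\mathcal M^+(E)_\sigma$ is the set of $\sigma$-additive measures on $E$. Convex combination means $\lambda_1,\lambda_2\ge0$, $\lambda_1+\lambda_2=1$. Uniqueness of the convex combination means: the coefficients $\lambda_i$ are uniquely determined, and $s_i$ is uniquely determined whenever $\lambda_i>0$; a term with coefficient $0$ may be omitted (relevant when no state of the required kind exists). *)

(* Defs.v *)
From mathcomp Require Import all_boot all_order all_algebra.
From mathcomp Require Import all_classical reals topology normedtype.

Set Implicit Arguments.
Unset Strict Implicit.
Unset Printing Implicit Defensive.

Import Order.TTheory GRing.Theory Num.Theory.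
Import numFieldNormedType.Exports.

Local Open Scope classical_set_scope.
Local Open Scope ring_scope.

(* [padd a b = Some c] means that a + b is defined and equal to c. With this
   encoding, the single equation [paddA] says both that one side of the
   associativity law exists iff the other one does, and that they agree. *)
Record pseudoEffectAlgebra := PseudoEffectAlgebra {
  pea_sort :> Type;
  padd : pea_sort -> pea_sort -> option pea_sort;
  pzero : pea_sort;
  pone : pea_sort;
  paddA : forall a b c : pea_sort,
    obind (fun x => padd x c) (padd a b) = obind (fun y => padd a y) (padd b c);
  pcompl_r : forall a : pea_sort, exists! d, padd a d = Some pone;
  pcompl_l : forall a : pea_sort, exists! e, padd e a = Some pone;
  pconj : forall a b c : pea_sort, padd a b = Some c ->
    exists d e, padd d a = Some c /\ padd b e = Some c;
  pone_max : forall a : pea_sort,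
    padd pone a <> None \/ padd a pone <> None -> a = pzero
}.

Arguments padd {p}.
Arguments pzero {p}.
Arguments pone {p}.

Section PseudoEffectAlgebra.
Variable E : pseudoEffectAlgebra.

Definition ple (a b : E) : Prop := exists c, padd a c = Some b.

Definition RDP : Prop :=
  forall a1 a2 b1 b2 c : E, padd a1 a2 = Some c -> padd b1 b2 = Some c ->
    exists d1 d2 d3 d4 : E,
      [/\ padd d1 d2 = Some a1, padd d3 d4 = Some a2,
          padd d1 d3 = Some b1 & padd d2 d4 = Some b2].

Definition is_psup (u : nat -> E) (a : E) : Prop :=
  (forall n, ple (u n) a) /\ (forall b, (forall n, ple (u n) b) -> ple a b).

Variable R : realType.

Definition is_measure (m : E -> R) : Prop :=
  (forall a, 0 <= m a) /\
  (forall a b c : E, padd a b = Some c -> m c = m a + m b).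

Definition is_state (s : E -> R) : Prop := is_measure s /\ s pone = 1.

Definition mle (m1 m2 : E -> R) : Prop := forall a, m1 a <= m2 a.

Definition is_sigma_additive (m : E -> R) : Prop :=
  forall (u : nat -> E) (a : E),
    (forall n, ple (u n) (u n.+1)) -> is_psup u a ->
    m (u n) @[n --> \oo] --> m a.

Definition is_sigma_measure (m : E -> R) : Prop :=
  is_measure m /\ is_sigma_additive m.

Definition is_sigma_state (s : E -> R) : Prop :=
  is_state s /\ is_sigma_additive s.

(* The measures and states allowed as the second, purely finitely additive,
   component of the decompositions. *)
Definition is_pfa_measure (m : E -> R) : Prop :=
  is_measure m /\
  (forall t, is_sigma_measure t -> mle t m -> t = (fun=> 0)).

Definition is_pfa_state (s : E -> R) : Prop :=
  is_state s /\
  (forall (s' : E -> R) (alpha : R), is_sigma_state s' -> 0 <= alpha ->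
     mle (fun a => alpha * s' a) s -> alpha = 0).

(* A term with coefficient 0 may be omitted from a convex combination, since
   there may be no state of the required kind: nothing is then asked of the
   corresponding function. *)
Definition is_state_decomposition
    (s : E -> R) (l1 l2 : R) (s1 s2 : E -> R) : Prop :=
  [/\ [/\ 0 <= l1, 0 <= l2 & l1 + l2 = 1],
      l1 = 0 \/ is_sigma_state s1,
      l2 = 0 \/ is_pfa_state s2 &
      s = (fun a => l1 * s1 a + l2 * s2 a)].

End PseudoEffectAlgebra.

(* Main.v *)
Require Import Defs.
From mathcomp Require Import all_boot all_order all_algebra.
From mathcomp Require Import all_classical reals topology normedtype.
From mathcomp Require Import lra.

(** The measures on [E] form a cone whose order is pointwise. Existence uses no
    Riesz property: a sigma-additive measure [m1] maximal among those below [m]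
    exists by Zorn's lemma, since a pointwise supremum of a chain of
    sigma-additive measures is sigma-additive, and [m - m1] is then purely
    finitely additive because [m1 + t] still competes with [m1]. Uniqueness is
    where (RDP) enters: it makes [a |-> inf {m x + n y | x + y = a}] additive,
    so if [m1 + m2 = n1 + n2] then [m1 - m1 /\ n1] is a sigma-additive measure
    below [n2], hence zero, and [m1 <= n1]. *)

Set Implicit Arguments.
Unset Strict Implicit.
Unset Printing Implicit Defensive.

Import Order.TTheory GRing.Theory Num.Theory.
Import numFieldNormedType.Exports.

Local Open Scope classical_set_scope.
Local Open Scope ring_scope.

(** * Reassociation, the neutral element and interchange in a pseudo effect algebra *)

Section PartialAddition.
Variable E : pseudoEffectAlgebra.
Implicit Types a b c x y z : E.

Lemma padd_assoc_right a b c x y : padd a b = Some x -> padd x c = Some y ->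
  exists2 z, padd b c = Some z & padd a z = Some y.
Proof.
move=> abx xcy; have := paddA a b c; rewrite abx /= xcy.
by case: (padd b c) => [z|] //= azy; exists z.
Qed.

Lemma padd_assoc_left a b c y z : padd b c = Some z -> padd a z = Some y ->
  exists2 x, padd a b = Some x & padd x c = Some y.
Proof.
move=> bcz azy; have := paddA a b c; rewrite bcz /= azy.
by case: (padd a b) => [x|] //= xcy; exists x.
Qed.

Lemma padd10 : padd pone pzero = Some (pone : E).
Proof.
have [d [d1 _]] := pcompl_r (pone : E).
by rewrite -[pzero](@pone_max E d) ?d1//; left.
Qed.

Lemma padd01 : padd pzero pone = Some (pone : E).
Proof.
have [d [d1 _]] := pcompl_l (pone : E).
by rewrite -[pzero](@pone_max E d) ?d1//; right.
Qed.

(** With [e + a = 1], reassociating [(e + a) + 0 = 1] makes [a + 0] a right complement of [e], and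
    such a complement is unique. *)
Lemma padd0 a : padd a pzero = Some a.
Proof.
have [e [ea1 _]] := pcompl_l a.
have [z az ez1] := padd_assoc_right ea1 padd10.
have [d [_ du]] := pcompl_r e.
by rewrite az -(du _ ea1) -(du _ ez1).
Qed.

Lemma padd0l a : padd pzero a = Some a.
Proof.
have [e [ae1 _]] := pcompl_r a.
have [z az ze1] := padd_assoc_left ae1 padd01.
have [d [_ du]] := pcompl_l e.
by rewrite az -(du _ ae1) -(du _ ze1).
Qed.

(* Addition is not commutative, so [x2] gets moved past [y1] at the price of
   being replaced by a conjugate [d]; measures do not see the difference. *)
Lemma padd_interchange x1 y1 x2 y2 a1 a2 c :
  padd x1 y1 = Some a1 -> padd x2 y2 = Some a2 -> padd a1 a2 = Some c ->
  exists d u v w, [/\ padd y1 x2 = Some w, padd d y1 = Some w,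
    padd x1 d = Some u, padd y1 y2 = Some v & padd u v = Some c].
Proof.
move=> xy1 xy2 aac.
have [z y1a2 x1z] := padd_assoc_right xy1 aac.
have [w y1x2 wy2] := padd_assoc_left xy2 y1a2.
have [d [_ [dy1 _]]] := pconj y1x2.
have [v y1y2 dv] := padd_assoc_right dy1 wy2.
have [u x1d uv] := padd_assoc_left dv x1z.
by exists d, u, v, w.
Qed.

End PartialAddition.

(** * The cone of measures and its sigma-additive members *)

Section Measures.
Variables (R : realType) (E : pseudoEffectAlgebra).
Implicit Types (m n t s : E -> R) (a b c x y : E).

Lemma measure_ple m a b : is_measure m -> ple a b -> m a <= m b.
Proof. by move=> [m0 mD] [c /mD ->]; rewrite lerDl. Qed.

Lemma measure_le_one m a : is_measure m -> m a <= m pone.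
Proof.
move=> mm; apply: measure_ple => //.
by have [d [ad _]] := pcompl_r a; exists d.
Qed.

Lemma measure0 m : is_measure m -> m pzero = 0.
Proof. by move=> [_ mD]; have := mD _ _ _ (padd0 (pzero : E)); lra. Qed.

Lemma measure_eq0 m : is_measure m -> m pone = 0 -> m = (fun=> 0).
Proof.
move=> mm m1; apply/funext => a; apply/eqP.
by rewrite eq_le mm.1 andbT -m1 measure_le_one.
Qed.

Lemma measure_zero : is_measure (fun=> 0 : R) (E := E).
Proof. by split=> // *; rewrite addr0. Qed.

Lemma measureD m n : is_measure m -> is_measure n ->
  is_measure (fun a => m a + n a).
Proof.
move=> [m0 mD] [n0 nD]; split=> [a|a b c abc]; first by rewrite addr_ge0.
by rewrite (mD _ _ _ abc) (nD _ _ _ abc) addrACA.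
Qed.

Lemma measureB m n : is_measure m -> is_measure n -> mle n m ->
  is_measure (fun a => m a - n a).
Proof.
move=> [m0 mD] [n0 nD] nm; split=> [a|a b c abc]; first by rewrite subr_ge0.
by rewrite (mD _ _ _ abc) (nD _ _ _ abc); lra.
Qed.

Lemma measureZ (k : R) m : 0 <= k -> is_measure m ->
  is_measure (fun a => k * m a).
Proof.
move=> k0 [m0 mD]; split=> [a|a b c abc]; first by rewrite mulr_ge0.
by rewrite (mD _ _ _ abc) mulrDr.
Qed.

(** Along an increasing [u] the values of [m] increase and stay below [m a], so a single good index
    [N] serves all later ones. *)
Lemma sigma_additiveP m : is_measure m ->
  is_sigma_additive m <->
  (forall (u : nat -> E) a, (forall i, ple (u i) (u i.+1)) -> is_psup u a ->
     forall e, 0 < e -> exists N, m a - m (u N) <= e).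
Proof.
move=> mm; split=> mS u a uS ua.
  move=> e e0; have /cvgrPdist_le /(_ e e0) [N _ /(_ N (leqnn N))] := mS u a uS ua.
  by move=> mN; exists N; apply: le_trans mN; exact: ler_norm.
apply/cvgrPdist_le => e e0; have [N mN] := mS u a uS ua e e0.
exists N => // k /= Nk; rewrite ger0_norm; last first.
  by rewrite subr_ge0; apply: measure_ple => //; exact: ua.1.
apply: le_trans mN; rewrite lerB//.
apply: (homo_leq (r := fun p q : R => p <= q) (f := m \o u)) Nk => //.
- by move=> q p r; exact: le_trans.
- by move=> i; exact: measure_ple.
Qed.

Lemma sigma_measure_zero : is_sigma_measure (fun=> 0 : R) (E := E).
Proof.
split; first exact: measure_zero.
by move=> u a _ _; exact: cvg_cst.
Qed.

Lemma sigma_measureD m n : is_sigma_measure m -> is_sigma_measure n ->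
  is_sigma_measure (fun a => m a + n a).
Proof.
move=> [mm mS] [nm nS]; split; first exact: measureD.
by move=> u a uS ua; apply: cvgD; [exact: mS|exact: nS].
Qed.

Lemma sigma_measureZ (k : R) m : 0 <= k -> is_sigma_measure m ->
  is_sigma_measure (fun a => k * m a).
Proof.
move=> k0 [mm mS]; split; first exact: measureZ.
by move=> u a uS ua; apply: cvgM; [exact: cvg_cst|exact: mS].
Qed.

(** Since [m - t] is monotone, the gap [t a - t (u N)] is at most [m a - m (u N)]. *)
Lemma sigma_measure_le m t : is_sigma_measure m -> is_measure t -> mle t m ->
  is_sigma_measure t.
Proof.
move=> [mm mS] tm tlem; split=> //; apply/sigma_additiveP => // u a uS ua e e0.
have [N mN] := (sigma_additiveP mm).1 mS u a uS ua e e0.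
exists N; apply: le_trans mN.
have := measure_ple (measureB mm tm tlem) (ua.1 N); lra.
Qed.

(** * Pointwise suprema of chains of sigma-additive measures *)

Section ChainSup.
Variables (A : set (E -> R)) (m : E -> R).
Hypotheses (A0 : A !=set0) (Atot : total_on A (@mle E R)).
Hypothesis Asigma : forall t, A t -> is_sigma_measure t.
Hypothesis Am : forall t, A t -> mle t m.

Let f a := sup [set t a | t in A].

Lemma chain_sup_ub t : A t -> mle t f.
Proof.
move=> At a; apply: ub_le_sup; last by exists t.
by exists (m a) => _ [s As <-]; exact: Am.
Qed.

Lemma chain_sup_le a (r : R) : (forall t, A t -> t a <= r) -> f a <= r.
Proof.
move=> tr; apply: ge_sup; first by have [t At] := A0; exists (t a), t.
by move=> _ [t At <-]; exact: tr.
Qed.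

Lemma chain_sup_sigma_measure : is_sigma_measure f.
Proof.
have fm : is_measure f.
  split=> [a|a b c abc].
    have [t At] := A0; apply: le_trans (chain_sup_ub At a).
    by have [[]] := Asigma At.
  have tD t : A t -> t c = t a + t b by move=> /Asigma [[_ +] _]; apply.
  apply/eqP; rewrite eq_le; apply/andP; split.
    by apply: chain_sup_le => t At; rewrite tD// lerD// chain_sup_ub.
  (* Superadditivity: [f a] and [f b] are approached by different members [t] and [s]; the larger of
     the two, evaluated at [c], bounds both. *)
  rewrite -lerBrDr; apply: chain_sup_le => t At; rewrite lerBrDl -lerBrDr.
  apply: chain_sup_le => s As; rewrite lerBrDr.
  have [ts|st] := Atot At As.
  - by have := chain_sup_ub As c; have := ts a; rewrite tD//; lra.
  - by have := chain_sup_ub At c; have := st b; rewrite tD//; lra.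
split=> //; apply/sigma_additiveP => // u a uS ua e e0.
(* One half of [e] pays for replacing [f] by [t], the other for the convergence of [t] along [u]. *)
have [t At te] : exists2 t, A t & f pone - e / 2 < t pone.
  apply: contrapT => tN; suff: f pone <= f pone - e / 2 by lra.
  by apply: chain_sup_le => t At; rewrite leNgt; apply/negP => ?; apply: tN; exists t.
have [tm tS] := Asigma At.
have [N tN] := (sigma_additiveP tm).1 tS u a uS ua (e / 2) ltac:(lra).
exists N.
(* [f - t] is a measure of total mass at most [e / 2], whatever [u] and [a] *)
have ftm := measureB fm tm (chain_sup_ub At).
have := measure_le_one a ftm; have := ftm.1 (u N); lra.
Qed.

End ChainSup.

(** * Existence of the decomposition by Zorn's lemma *)

Lemma exists_maximal_sigma_measure m : is_measure m ->
  exists m1, [/\ is_sigma_measure m1, mle m1 m &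
    forall t, is_sigma_measure t -> mle t m -> mle m1 t -> mle t m1].
Proof.
move=> mm; pose T := {t : E -> R | is_sigma_measure t /\ mle t m}.
have z : T by exists (fun=> 0); split; [exact: sigma_measure_zero|exact: mm.1].
pose r (s t : T) := `[< mle (sval s) (sval t) >].
have [||A Atot|[m1 [m1S m1m]] m1max] := @ZL_preorder T z r.
- by move=> t; apply/asboolP => a.
- move=> s t w /asboolP st /asboolP sw; apply/asboolP => a.
  exact: le_trans (st a) (sw a).
(* The empty chain needs a bound too; the zero measure [z] provides it. *)
- have [A0|/set0P/negP] := pselect (A !=set0); last first.
    by rewrite negbK => /eqP ->; exists z.
  pose B := sval @` A.
  have B0 : B !=set0 by have [t At] := A0; exists (sval t), t.
  have Btot : total_on B (@mle E R).
    move=> _ _ [s As <-] [t At <-].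
    by have [/asboolP|/asboolP] := Atot s t As At; [left|right].
  have BS t : B t -> is_sigma_measure t by move=> [s _ <-]; exact: (svalP s).1.
  have Bm t : B t -> mle t m by move=> [s _ <-]; exact: (svalP s).2.
  have fm : mle (fun a => sup [set t a | t in B]) m.
    by move=> a; apply: chain_sup_le => // t /Bm.
  exists (exist (fun t => is_sigma_measure t /\ mle t m) _
    (conj (chain_sup_sigma_measure B0 Btot BS Bm) fm)) => s As.
  by apply/asboolP; apply: (chain_sup_ub Bm); exists s.
- exists m1; split=> // t tS tm m1t.
  exact/asboolP/(m1max (exist _ t (conj tS tm)))/asboolP.
Qed.

Lemma sigma_pfa_decomposition m : is_measure m ->
  exists m1 m2, [/\ is_sigma_measure m1, is_pfa_measure m2 &
    m = (fun a => m1 a + m2 a)].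
Proof.
move=> mm; have [m1 [m1S m1m m1max]] := exists_maximal_sigma_measure mm.
exists m1, (fun a => m a - m1 a); split=> //; last first.
  by apply/funext => a; rewrite addrC subrK.
split; first exact: (measureB mm m1S.1 m1m).
move=> t tS tm; apply: measure_eq0; first exact: tS.1.
have t0 := tS.1.1; apply/eqP; rewrite eq_le t0 andbT -(lerD2l (m1 pone)) addr0.
(* Maximality applied to [m1 + t] and read at [pone] gives [t pone <= 0], and total mass zero forces
   [t = 0]. *)
by apply: (m1max _ (sigma_measureD m1S tS)) => a; [have := tm a|have := t0 a]; lra.
Qed.

(** * The infimum of two measures under (RDP) *)

Section Meet.
Variables m n : E -> R.
Hypotheses (mm : is_measure m) (nm : is_measure n).

(** The Riesz-Kantorovich formula for the infimum of [m] and [n]. *)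
Definition measure_meet a : R :=
  inf [set m p.1 + n p.2 | p in [set p : E * E | padd p.1 p.2 = Some a]].

Lemma measure_meet_lb x y a : padd x y = Some a -> measure_meet a <= m x + n y.
Proof.
move=> xya; apply: ge_inf; last by exists (x, y).
by exists 0 => _ [p _ <-]; rewrite addr_ge0// ?mm.1 ?nm.1.
Qed.

Lemma le_measure_meet (r : R) a :
  (forall x y, padd x y = Some a -> r <= m x + n y) -> r <= measure_meet a.
Proof.
move=> rmn; apply: lb_le_inf; last by move=> _ [p pa <-]; exact: rmn.
by exists (m a + n pzero), (a, pzero) => //=; exact: padd0.
Qed.

Lemma measure_meet_lel : mle measure_meet m.
Proof. by move=> a; have := measure_meet_lb (padd0 a); rewrite (measure0 nm) addr0. Qed.

Lemma measure_meet_ler : mle measure_meet n.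
Proof. by move=> a; have := measure_meet_lb (padd0l a); rewrite (measure0 mm) add0r. Qed.

(** (RDP) refines a splitting of [c] into splittings of [a1] and [a2], which gives superadditivity.
    For subadditivity, splittings of [a1] and [a2] are merged by [padd_interchange]. *)
Lemma measure_meet_measure : RDP E -> is_measure measure_meet.
Proof.
move=> hE; split=> [a|a1 a2 c aac].
  by apply: le_measure_meet => x y _; rewrite addr_ge0// ?mm.1 ?nm.1.
apply/eqP; rewrite eq_le; apply/andP; split; last first.
  apply: le_measure_meet => x y xyc.
  have [d1 [d2 [d3 [d4 [d12 d34 d13 d24]]]]] := hE _ _ _ _ _ aac xyc.
  have := measure_meet_lb d12; have := measure_meet_lb d34.
  by rewrite (mm.2 _ _ _ d13) (nm.2 _ _ _ d24); lra.
rewrite -lerBlDr; apply: le_measure_meet => x1 y1 xy1; rewrite lerBlDl -lerBlDr.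
apply: le_measure_meet => x2 y2 xy2.
have [d [u [v [w [yx dy xd yy uv]]]]] := padd_interchange xy1 xy2 aac.
have := measure_meet_lb uv.
rewrite (mm.2 _ _ _ xd) (nm.2 _ _ _ yy).
(* Both [y1 + x2] and [d + y1] equal [w], so cancelling [m y1] yields [m d = m x2]. *)
by have := mm.2 _ _ _ yx; have := mm.2 _ _ _ dy; lra.
Qed.

End Meet.

(** * Uniqueness of the decomposition of a measure *)

Lemma sigma_le_of_sum_eq m1 m2 n1 n2 : RDP E ->
  is_sigma_measure m1 -> is_measure m2 -> is_sigma_measure n1 ->
  is_pfa_measure n2 -> (forall a, m1 a + m2 a = n1 a + n2 a) -> mle m1 n1.
Proof.
move=> hE m1S m2m n1S [n2m n2P] mn.
have m1m := m1S.1; have n1m := n1S.1.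
have ml := measure_meet_lel m1m n1m.
have fm := measure_meet_measure m1m n1m hE.
have tS : is_sigma_measure (fun a => m1 a - measure_meet m1 n1 a).
  apply: (sigma_measure_le m1S (measureB m1m fm ml)) => a.
  by rewrite gerBl fm.1.
have t0 : (fun a => m1 a - measure_meet m1 n1 a) = (fun=> 0).
  apply: n2P => // a.
  (* For [x + y = a] the claim becomes [m1 y <= n1 y + n2 y + n2 x], which follows from the equality
     of the two sums at [y]. *)
  rewrite lerBlDl -lerBlDr; apply: le_measure_meet => x y xya.
  rewrite (m1m.2 _ _ _ xya) (n2m.2 _ _ _ xya).
  by have := mn y; have := m2m.1 y; have := n2m.1 x; lra.
move=> a; have := congr1 (fun g => g a) t0 => /= /eqP; rewrite subr_eq0 => /eqP ->.
exact: measure_meet_ler.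
Qed.

Lemma sigma_pfa_unique m1 m2 n1 n2 : RDP E ->
  is_sigma_measure m1 -> is_pfa_measure m2 ->
  is_sigma_measure n1 -> is_pfa_measure n2 ->
  (forall a, m1 a + m2 a = n1 a + n2 a) -> m1 = n1 /\ m2 = n2.
Proof.
move=> hE m1S m2P n1S n2P mn.
have mn1 a : m1 a = n1 a.
  apply/eqP; rewrite eq_le (sigma_le_of_sum_eq hE m1S m2P.1 n1S n2P mn)/=.
  by apply: (sigma_le_of_sum_eq hE n1S n2P.1 m1S m2P) => b; rewrite mn.
by split; apply/funext => a //; have := mn a; rewrite mn1 => /addrI.
Qed.

(** * Passing between measures and states by normalization *)

Lemma pfa_measureZ (k : R) m : 0 <= k -> is_pfa_measure m ->
  is_pfa_measure (fun a => k * m a).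
Proof.
move=> k0 [mm mP]; split=> [|t tS tm]; first exact: measureZ.
have [k1|k1] := eqVneq k 0.
  apply: measure_eq0; first exact: tS.1.
  by apply/eqP; rewrite eq_le tS.1.1 andbT (le_trans (tm _))// k1 mul0r.
have kt0 : (fun a => k^-1 * t a) = (fun=> 0).
  apply: mP => [|a]; first by apply: sigma_measureZ => //; rewrite invr_ge0.
  by rewrite mulrC ler_pdivrMr ?lt_def ?k1// mulrC.
apply/funext => a; have /eqP := congr1 (fun g => g a) kt0.
by rewrite /= mulf_eq0 invr_eq0 (negbTE k1) => /eqP.
Qed.

Lemma state_normalize m : is_measure m -> 0 < m pone ->
  is_state (fun a => (m pone)^-1 * m a).
Proof.
move=> mm m1; split; first by apply: measureZ => //; rewrite invr_ge0 ltW.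
by rewrite mulVf// gt_eqF.
Qed.

Lemma sigma_state_normalize m : is_sigma_measure m -> 0 < m pone ->
  is_sigma_state (fun a => (m pone)^-1 * m a).
Proof.
move=> mS m1; split; first exact: (state_normalize mS.1).
by apply: (sigma_measureZ _ mS).2; rewrite invr_ge0 ltW.
Qed.

(** A nonzero sigma-additive measure [t] is [t pone] times a sigma-additive state, so [alpha] plays
    the role of the total mass. *)
Lemma pfa_stateP s : is_pfa_state s <-> is_state s /\ is_pfa_measure s.
Proof.
split=> [[ss sP]|[ss [sm sP]]]; split=> //.
  split=> [|t tS ts]; first exact: ss.1.
  apply: measure_eq0; first exact: tS.1.
  apply: contrapT => /eqP t1.
  have {}t1 : 0 < t pone by rewrite lt_def t1 tS.1.1.
  have := sP _ _ (sigma_state_normalize tS t1) (ltW t1).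
  suff -> : (fun a => t pone * ((t pone)^-1 * t a)) = t by move=> /(_ ts); lra.
  by apply/funext => a; rewrite mulrA mulfV ?mul1r// gt_eqF.
move=> s' k [[s'm s'1] s'S] k0 ks.
have := sP _ (sigma_measureZ k0 (conj s'm s'S)) ks.
by move=> /(congr1 (fun g => g pone)); rewrite s'1 mulr1.
Qed.

(** This includes total mass zero, where [m] itself vanishes; a term of coefficient 0 thus needs no
    separate treatment. *)
Lemma scaled_normalize m a : is_measure m ->
  m pone * ((m pone)^-1 * m a) = m a.
Proof.
move=> mm; have [m1|m1] := eqVneq (m pone) 0.
  by rewrite (measure_eq0 mm m1) mul0r.
by rewrite mulrA mulfV ?mul1r.
Qed.

Lemma state_decomposition_of_measures s m1 m2 : is_state s ->
  is_sigma_measure m1 -> is_pfa_measure m2 -> s = (fun a => m1 a + m2 a) ->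
  is_state_decomposition s (m1 pone) (m2 pone)
    (fun a => (m1 pone)^-1 * m1 a) (fun a => (m2 pone)^-1 * m2 a).
Proof.
move=> ss m1S m2P sE; split.
- by split; rewrite ?m1S.1.1 ?m2P.1.1// -ss.2 sE.
- have [->|m11] := eqVneq (m1 pone) 0; [by left|right].
  by apply: sigma_state_normalize => //; rewrite lt_def m11 m1S.1.1.
- have [->|m21] := eqVneq (m2 pone) 0; [by left|right].
  have m21' : 0 < m2 pone by rewrite lt_def m21 m2P.1.1.
  apply/pfa_stateP; split; first exact: (state_normalize m2P.1).
  by apply: pfa_measureZ => //; rewrite invr_ge0 ltW.
- rewrite sE; apply/funext => a.
  by rewrite !scaled_normalize//; [exact: m2P.1|exact: m1S.1].
Qed.

(** Reduces uniqueness for states to uniqueness for measures. A term with coefficient 0 becomes the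
    zero measure, which is both sigma-additive and purely finitely additive, however arbitrary its
    function. *)
Lemma state_decomposition_measures s (k1 k2 : R) t1 t2 :
  is_state_decomposition s k1 k2 t1 t2 ->
  [/\ is_sigma_measure (fun a => k1 * t1 a), is_pfa_measure (fun a => k2 * t2 a),
      k1 * t1 pone = k1 & k2 * t2 pone = k2].
Proof.
move=> [[k10 k20 _] t1S t2P _]; split.
- case: t1S => [->|[[t1m _] t1S]]; last exact: sigma_measureZ.
  under eq_fun do rewrite mul0r; exact: sigma_measure_zero.
- case: t2P => [->|/pfa_stateP[_ t2P]]; last exact: pfa_measureZ.
  under eq_fun do rewrite mul0r; split; first exact: measure_zero.
  move=> t tS t0; apply/funext => a; apply/eqP.
  by rewrite eq_le t0 tS.1.1.
- by case: t1S => [->|[[_ ->] _]]; rewrite ?mul0r ?mulr1.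
- by case: t2P => [->|[[_ ->] _]]; rewrite ?mul0r ?mulr1.
Qed.

End Measures.

Theorem theorem4p5 (R : realType) (E : pseudoEffectAlgebra) (hE : RDP E) :
  (forall m : E -> R, is_measure m ->
     exists! p : (E -> R) * (E -> R),
       [/\ is_sigma_measure p.1, is_pfa_measure p.2 &
           m = (fun a => p.1 a + p.2 a)]) /\
  (forall s : E -> R, is_state s ->
     exists (l1 l2 : R) (s1 s2 : E -> R),
       is_state_decomposition s l1 l2 s1 s2 /\
       (forall (k1 k2 : R) (t1 t2 : E -> R),
          is_state_decomposition s k1 k2 t1 t2 ->
          [/\ k1 = l1, k2 = l2, 0 < l1 -> t1 = s1 & 0 < l2 -> t2 = s2])).
Proof.
split=> [m mm|s ss].
  have [m1 [m2 [m1S m2P mE]]] := sigma_pfa_decomposition mm.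
  exists (m1, m2); split=> // -[n1 n2] /= [n1S n2P nE].
  have [a|-> -> //] := sigma_pfa_unique hE m1S m2P n1S n2P.
  by move: mE; rewrite nE => /(congr1 (fun g => g a)).
have [m1 [m2 [m1S m2P sE]]] := sigma_pfa_decomposition ss.1.
exists (m1 pone), (m2 pone).
exists (fun a => (m1 pone)^-1 * m1 a), (fun a => (m2 pone)^-1 * m2 a).
split; first exact: state_decomposition_of_measures.
move=> k1 k2 t1 t2 dec.
have [n1S n2P k1E k2E] := state_decomposition_measures dec.
have [a|m1E m2E] := sigma_pfa_unique hE m1S m2P n1S n2P.
  by case: dec => _ _ _; rewrite sE => /(congr1 (fun g => g a)).
have k1m : m1 pone = k1 by rewrite m1E.
have k2m : m2 pone = k2 by rewrite m2E.
(* The scaled terms agree, so a positive coefficient can be divided out to recover the state. *)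
rewrite k1m k2m m1E m2E; split=> // k0; apply/funext => a;
  by rewrite mulKf// gt_eqF.
Qed.
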